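(* Let $Y$ be a space with $\pi_1(Y)$ perfect. Then, for any abelian group $V$, any finite-degree invariant $f\colon\pi_1(Y)\to V$ is constant.
   Context: $\mathbb N=\{0,1,2,\dots\}$. ''Space'' means pointed topological space; ''map'' means basepoint-preserving continuous map; homotopies are pointed, $[X,Y]$ is the set of pointed homotopy classes of maps $X\to Y$, and $\pi_n(Y)=[S^n,Y]$. For a space $X$, $C_0(X)$ denotes the group of unreduced zero-dimensional chains with integer coefficients, i.e. the free abelian group on all points of $X$. A map $a\colon X\to Y$ and a number $r\in\mathbb N$ give the Cartesian power $a^r\colon X^r\to Y^r$ and the induced homomorphism $C_0(a^r)\colon C_0(X^r)\to C_0(Y^r)$. For an abelian group $V$ and a function $f\colon[X,Y]\to V$ (called an invariant), the degree $\operatorname{Deg} f\in\mathbb N\cup\{\infty\}$ is defined by: $\operatorname{Deg} f\le r$ if and only if there is a homomorphism of abelian groups $l\colon\operatorname{Hom}(C_0(X^r),C_0(Y^r))\to V$ such that $f([a])=l(C_0(a^r))$ for all maps $a\colon X\to Y$. A finite-degree invariant is one with $\operatorname{Deg} f<\infty$. *)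

(* Defs.v *)
From HB Require Import structures.
From mathcomp Require Import all_boot all_order all_algebra generic_quotient.
From mathcomp Require Import all_classical reals.
From mathcomp Require Import topology normedtype realfun trigo.
From mathcomp Require Import ring lra.
From mathcomp.multinomials Require Import freeg.

Set Implicit Arguments.
Unset Strict Implicit.
Unset Printing Implicit Defensive.

Import Order.TTheory GRing.Theory Num.Theory numFieldNormedType.Exports.
Local Open Scope classical_set_scope.
Local Open Scope ring_scope.
Local Open Scope quotient_scope.

Section ContinuityHelpers.
Variable R : realType.

Lemma continuous_comp_within (T U V : topologicalType) (A : set U)
    (f : T -> U) (g : U -> V) :
  (forall x, A (f x)) -> continuous f -> {within A, continuous g} ->
  continuous (g \o f).
Proof.
move=> fA cf /subspace_continuousP cg x.
move=> B /(cg _ (fA x)) gB.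
have {}gB : nbhs (f x) [set y | A y -> B (g y)] by exact: gB.
by move/cf: gB; apply: (@filterS _ (nbhs x)) => y /=; exact.
Qed.

Lemma continuous_glue (T U : topologicalType) (P : T -> R) (f g : T -> U) :
  continuous P -> continuous f -> continuous g ->
  (forall x, P x = 0 -> f x = g x) ->
  continuous (fun x => if 0 <= P x then f x else g x).
Proof.
move=> cP cf cg fg; apply/continuous_subspace_setT.
have -> : [set: T] = P @^-1` [set t | 0 <= t] `|` P @^-1` [set t | t <= 0].
  by apply/seteqP; split=> // x _ /=; case: (leP 0 (P x)) => [|/ltW]; [left|right].
apply: withinU_continuous.
- exact: (continuous_closedP P).1 cP _ (@closed_ge _ 0).
- exact: (continuous_closedP P).1 cP _ (@closed_le _ 0).
- apply: subspace_eq_continuous (continuous_subspaceT cf) => x.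
  by rewrite inE /= => Px; rewrite /from_subspace Px.
- apply: subspace_eq_continuous (continuous_subspaceT cg) => x.
  rewrite inE /= => Px; rewrite /from_subspace; case: ifPn => // Px'; apply/esym/fg/eqP.
  by rewrite eq_le Px Px'.
Qed.

Lemma continuous_pair (T U V : topologicalType) (f : T -> U) (g : T -> V) :
  continuous f -> continuous g -> continuous (fun x => (f x, g x)).
Proof. by move=> cf cg x; apply: cvg_pair; [exact: cf|exact: cg]. Qed.

End ContinuityHelpers.

Section PointedMaps.
Variables X Y : ptopologicalType.

Record ptmap := PtMap {
  ptmap_fun :> X -> Y;
  ptmap_continuous : continuous ptmap_fun;
  ptmap_point : ptmap_fun point = point }.

HB.instance Definition _ := gen_eqMixin ptmap.
HB.instance Definition _ := gen_choiceMixin ptmap.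

Lemma ptmap_eq (a b : ptmap) : a =1 b -> a = b.
Proof.
case: a b => [a ca pa] [b cb pb] /= /funext ab; subst b.
by congr PtMap; exact: Prop_irrelevance.
Qed.

Definition ptmap_cst : ptmap := PtMap (@cst_continuous X Y point) erefl.

End PointedMaps.

Section Homotopy.
Variables (R : realType) (X Y : ptopologicalType).

Definition homotopic (a b : ptmap X Y) : Prop :=
  exists H : R * X -> Y,
    [/\ {within `[0, 1]%classic `*` setT, continuous H},
        forall x, H (0, x) = a x,
        forall x, H (1, x) = b x &
        forall t, 0 <= t <= 1 -> H (t, point) = point].

(* A homotopy extends to all times by clamping the time parameter. *)
Lemma homotopicP (a b : ptmap X Y) : homotopic a b <->
  exists H : R * X -> Y, [/\ continuous H, forall x, H (0, x) = a x,
     forall x, H (1, x) = b x & forall t, H (t, point) = point].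
Proof.
split=> [[H [cH H0 H1 Hp]]|[H [cH H0 H1 Hp]]]; last first.
  by exists H; split=> //; exact: continuous_subspaceT.
pose k (t : R) : R := Num.max 0 (Num.min 1 t).
have k01 t : 0 <= k t <= 1.
  by rewrite /k le_max lexx /= ge_max ler01 ge_min lexx.
have ck : continuous k.
  move=> t; apply: (@continuous_max _ _ (cst 0)); first exact: cst_continuous.
  apply: (@continuous_min _ _ (cst 1)); first exact: cst_continuous.
  exact: cvg_id.
exists (H \o (fun p => (k p.1, p.2))); split=> /=.
- apply: continuous_comp_within cH.
    by move=> p; split=> //=; rewrite in_itv /= k01.
  apply: continuous_pair; last by move=> ?; exact: cvg_snd.
  by move=> p; apply: continuous_comp; [exact: cvg_fst|exact: ck].
- by move=> x; rewrite /k minEle ler10 maxxx H0.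
- by move=> x; rewrite /k minxx maxEle ler01 H1.
- by move=> t; rewrite Hp.
Qed.

Lemma homotopic_refl a : homotopic a a.
Proof.
apply/homotopicP; exists (a \o snd); split=> //= [|_]; last exact: ptmap_point.
by move=> p; apply: continuous_comp; [exact: cvg_snd|exact: ptmap_continuous].
Qed.

Lemma continuous_time (H : R * X -> Y) (k : R -> R) :
  continuous k -> continuous H -> continuous (fun p => H (k p.1, p.2)).
Proof.
move=> ck cH p; apply: (@continuous_comp _ _ _ (fun p => (k p.1, p.2))) (cH _).
apply: continuous_pair; last by move=> ?; exact: cvg_snd.
by move=> q; apply: continuous_comp; [exact: cvg_fst|exact: ck].
Qed.

Lemma continuous_affine (u v : R) : continuous (fun t : R => u * t + v).
Proof.
by move=> t; apply: cvgD; [apply: cvgM; [exact: cvg_cst|exact: cvg_id]|exact: cvg_cst].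
Qed.

Lemma homotopic_sym a b : homotopic a b -> homotopic b a.
Proof.
move=> /homotopicP[H [cH H0 H1 Hp]]; apply/homotopicP.
exists (fun p => H (-1 * p.1 + 1, p.2)); split=> /= [|x|x|t].
- exact: continuous_time (@continuous_affine _ _) cH.
- by rewrite mulr0 add0r H1.
- by rewrite mulr1 addNr H0.
- exact: Hp.
Qed.

Lemma homotopic_trans a b c :
  homotopic a b -> homotopic b c -> homotopic a c.
Proof.
move=> /homotopicP[H [cH H0 H1 Hp]] /homotopicP[K [cK K0 K1 Kp]].
apply/homotopicP.
exists (fun p => if 0 <= -2 * p.1 + 1 then H (2 * p.1 + 0, p.2)
                 else K (2 * p.1 + -1, p.2)); split=> /= [|x|x|t].
- apply: (@continuous_glue R (R * X)%type Y (fun p => -2 * p.1 + 1)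
    (fun p => H (2 * p.1 + 0, p.2)) (fun p => K (2 * p.1 + -1, p.2))).
  + move=> p; apply: (@continuous_comp _ _ _ fst (fun t : R => -2 * t + 1)).
      exact: cvg_fst.
    exact: continuous_affine.
  + exact: continuous_time (@continuous_affine _ _) cH.
  + exact: continuous_time (@continuous_affine _ _) cK.
  + move=> [t x] /= t0.
    have -> : 2 * t + 0 = 1 by lra.
    by have -> : 2 * t + -1 = 0 by [lra|]; rewrite H1 K0.
- by rewrite !mulr0 !add0r ler01 H0.
- rewrite !mulr1 ifF; last by apply/negP; lra.
  by have -> : 2 + -1 = 1 :> R by [lra|]; rewrite K1.
- by rewrite Hp Kp if_same.
Qed.

Definition homotopicb (a b : ptmap X Y) : bool := `[< homotopic a b >].

Lemma homotopicb_refl : reflexive homotopicb.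
Proof. by move=> a; apply/asboolP; exact: homotopic_refl. Qed.

Lemma homotopicb_sym : symmetric homotopicb.
Proof. by move=> a b; apply/asboolP/asboolP => /homotopic_sym. Qed.

Lemma homotopicb_trans : transitive homotopicb.
Proof.
by move=> b a c /asboolP ab /asboolP bc; apply/asboolP/(homotopic_trans ab).
Qed.

Canonical homotopicb_equiv :=
  EquivRel homotopicb homotopicb_refl homotopicb_sym homotopicb_trans.

(* [X, Y], with homotopies parametrised by the unit interval of R. *)
Definition hclasses := {eq_quot homotopicb}.

HB.instance Definition _ := Choice.on hclasses.
HB.instance Definition _ := EqQuotient.on hclasses.

Definition hclass (a : ptmap X Y) : hclasses := \pi_hclasses a.

Lemma hclass_eq a b : hclass a = hclass b <-> homotopic a b.
Proof.
by split=> [/eqquotP/asboolP|ab]; [|apply/eqquotP/asboolP].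
Qed.

Lemma hclass_surj (u : hclasses) : exists a, u = hclass a.
Proof. by exists (repr u); rewrite /hclass reprK. Qed.

End Homotopy.

Section Circle.
Variable R : realType.

Definition unit_circle : set (R * R) := [set z | z.1 ^+ 2 + z.2 ^+ 2 = 1].

Definition circle : Type := unit_circle.

HB.instance Definition _ := Topological.copy circle unit_circle.

Implicit Types z : circle.

Definition re z : R := (val z).1.
Definition im z : R := (val z).2.

Lemma circleP z : re z ^+ 2 + im z ^+ 2 = 1.
Proof. exact: set_mem (valP z). Qed.

Definition mkcircle (x y : R) (xy : x ^+ 2 + y ^+ 2 = 1) : circle :=
  exist _ (x, y) (mem_set (xy : unit_circle (x, y))).

Lemma circle_eq z w : re z = re w -> im z = im w -> z = w.
Proof.
case: z w => [[x y] p] [[x' y'] q]; rewrite /re /im /= => xx' yy'.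
by apply: val_inj; rewrite /= xx' yy'.
Qed.

Lemma one_subproof : 1 ^+ 2 + 0 ^+ 2 = 1 :> R. Proof. by ring. Qed.

HB.instance Definition _ := isPointed.Build circle (mkcircle one_subproof).

Lemma re_point : re point = 1. Proof. by []. Qed.
Lemma im_point : im point = 0. Proof. by []. Qed.

Lemma sqr_subproof z :
  (re z ^+ 2 - im z ^+ 2) ^+ 2 + (2 * re z * im z) ^+ 2 = 1.
Proof.
transitivity ((re z ^+ 2 + im z ^+ 2) ^+ 2); first by ring.
by rewrite circleP expr1n.
Qed.

(* z |-> z ^ 2 and z |-> z^-1 on the unit complex numbers. *)
Definition circle_sqr z : circle := mkcircle (sqr_subproof z).

Lemma conj_subproof z : re z ^+ 2 + (- im z) ^+ 2 = 1.
Proof. by rewrite sqrrN circleP. Qed.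

Definition circle_conj z : circle := mkcircle (conj_subproof z).

Lemma circle_val_continuous : continuous (val : circle -> R * R).
Proof. exact: (@initial_continuous unit_circle _ set_val). Qed.

Lemma re_continuous : continuous re.
Proof.
by move=> z; apply: continuous_comp; [exact: circle_val_continuous|exact: cvg_fst].
Qed.

Lemma im_continuous : continuous im.
Proof.
by move=> z; apply: continuous_comp; [exact: circle_val_continuous|exact: cvg_snd].
Qed.

Lemma continuous_to_circle (T : topologicalType) (f : T -> circle) :
  continuous (re \o f) -> continuous (im \o f) -> continuous f.
Proof.
move=> cr ci; apply: (@continuous_comp_initial unit_circle T _ set_val f).
have -> : set_val \o f = (fun x => ((re \o f) x, (im \o f) x)).
  by apply/funext => x; rewrite /re /im /=; case: (f x) => -[].
exact: continuous_pair.
Qed.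

Lemma circle_sqr_continuous : continuous circle_sqr.
Proof.
have cX (f : circle -> R) : continuous f -> continuous (fun z => f z ^+ 2).
  move=> cf z; apply: (@continuous_comp _ _ _ f (fun x : R => x ^+ 2)) (cf z) _.
  exact: exprn_continuous.
apply: continuous_to_circle.
  rewrite -[_ \o _]/(fun z => re z ^+ 2 - im z ^+ 2) => z.
  exact: cvgB (cX _ re_continuous z) (cX _ im_continuous z).
rewrite -[_ \o _]/(fun z => 2 * re z * im z) => z.
apply: (@continuousM _ _ (fun z => 2 * re z) im); last exact: im_continuous.
apply: (@continuousM _ _ (cst 2) re); last exact: re_continuous.
exact: cst_continuous.
Qed.

Lemma circle_conj_continuous : continuous circle_conj.
Proof.
apply: continuous_to_circle; first exact: re_continuous.
rewrite -[_ \o _]/(fun z => - im z) => z.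
apply: (@continuousN _ _ _ im); exact: im_continuous.
Qed.

Lemma circle_sqr_im0 z : im z = 0 -> circle_sqr z = point.
Proof.
move=> z0; have := circleP z; rewrite z0 expr0n addr0 => x1.
apply: circle_eq; first by rewrite -[LHS]/(re z ^+ 2 - im z ^+ 2) z0 x1 expr0n subr0.
by rewrite -[LHS]/(2 * re z * im z) z0 mulr0.
Qed.

Lemma circle_sqr_point : circle_sqr point = point.
Proof. exact: circle_sqr_im0. Qed.

Lemma circle_conj_point : circle_conj point = point.
Proof. by apply: circle_eq => //; exact: oppr0. Qed.

Definition circle_exp_subproof (t : R) :
  cos (2 * pi * t) ^+ 2 + sin (2 * pi * t) ^+ 2 = 1 := cos2Dsin2 _.

Definition circle_exp (t : R) : circle := mkcircle (circle_exp_subproof t).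

Lemma circle_exp_continuous : continuous circle_exp.
Proof.
have cl : continuous (fun t : R => 2 * pi * t).
  by move=> t; apply: cvgM; [exact: cvg_cst|exact: cvg_id].
apply: continuous_to_circle => t; apply: continuous_comp (cl t) _.
  exact: continuous_cos.
exact: continuous_sin.
Qed.

Lemma circle_exp0 : circle_exp 0 = point.
Proof. by apply: circle_eq; rewrite /re /im /= mulr0 ?cos0 ?sin0. Qed.

Lemma circle_expD1 t : circle_exp (t + 1) = circle_exp t.
Proof.
have e : 2 * pi * (t + 1) = 2 * pi * t + pi *+ 2 :> R by ring.
by apply: circle_eq; rewrite /re /im /= e ?cosD2pi ?sinD2pi.
Qed.

Lemma circle_exp1 : circle_exp 1 = point.
Proof. by rewrite -[1]add0r circle_expD1 circle_exp0. Qed.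

Lemma circle_sqr_exp t : circle_sqr (circle_exp t) = circle_exp (2 * t).
Proof.
have e : 2 * pi * (2 * t) = (2 * pi * t) *+ 2 :> R by ring.
apply: circle_eq; rewrite /re /im /= /re /im /= e.
  by rewrite cos_mulr2n sin2cos2; ring.
by rewrite sin_mulr2n; ring.
Qed.

Lemma circle_conj_exp t : circle_conj (circle_exp t) = circle_exp (1 - t).
Proof.
have e : 2 * pi * (1 - t) = - (2 * pi * t) + pi *+ 2 :> R by ring.
by apply: circle_eq;
  rewrite /re /im /= /re /im /= e ?cosD2pi ?sinD2pi ?cosN ?sinN.
Qed.

Lemma im_exp_ge0 t : 0 <= t <= 1 -> (0 <= im (circle_exp t)) = (t <= 2^-1) || (t == 1).
Proof.
have pi0 := pi_gt0 R.
move=> /andP[t0 t1]; rewrite /im /=; have [->|tn1] := eqVneq t 1.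
  have -> : 2 * pi * 1 = pi *+ 2 :> R by ring.
  by rewrite sin2pi lexx orbT.
rewrite orbF; have [th|th] := leP t 2^-1.
  by apply: sin_ge0_pi; apply/andP; split; nra.
have -> : 2 * pi * t = (2 * pi * t - pi) + pi by ring.
rewrite sinDpi; apply/negbTE; rewrite -ltNge oppr_lt0; apply: sin_gt0_pi.
have {}t1 : t < 1 by rewrite lt_neqAle tn1.
by apply/andP; split; nra.
Qed.

Definition circle_arg z : R :=
  if 0 <= im z then acos (re z) / (2 * pi) else 1 - acos (re z) / (2 * pi).

Lemma re_itv z : -1 <= re z <= 1.
Proof.
rewrite -ler_norml -(@ler_pXn2r _ 2) // ?nnegrE // expr1n real_normK ?num_real //.
by rewrite -(circleP z) lerDl sqr_ge0.
Qed.

Lemma circle_argK z : circle_exp (circle_arg z) = z.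
Proof.
have pi0 := pi_gt0 R.
have rz := re_itv z.
have [/andP[a0 api] ca] := acos_def rz.
have sa : sin (acos (re z)) = `|im z|.
  by rewrite sin_acos // -sqrtr_sqr -(circleP z) addrAC subrr add0r.
have e : 2 * pi * (acos (re z) / (2 * pi)) = acos (re z) by field; lra.
have e' : 2 * pi * (1 - acos (re z) / (2 * pi)) = - acos (re z) + pi *+ 2.
  by field; lra.
rewrite /circle_arg; case: leP => z0;
  apply: circle_eq; rewrite /re /im /= ?e ?e' ?cosD2pi ?sinD2pi ?cosN ?sinN ?ca ?sa //.
  by rewrite ger0_norm.
by rewrite ltr0_norm ?opprK.
Qed.

Lemma circle_arg01 z : 0 <= circle_arg z <= 1.
Proof.
have pi0 := pi_gt0 R.
have [/andP[a0 api] _] := acos_def (re_itv z).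
have h0 : 0 <= acos (re z) / (2 * pi) by apply: divr_ge0 => //; lra.
have h1 : acos (re z) / (2 * pi) <= 1 by rewrite ler_pdivrMr; lra.
by rewrite /circle_arg; case: ifP => _; lra.
Qed.

Lemma circle_expK t : 0 <= t <= 1 -> t != 1 -> circle_arg (circle_exp t) = t.
Proof.
have pi0 := pi_gt0 R.
move=> t01 tn1; rewrite /circle_arg im_exp_ge0 // (negbTE tn1) orbF /re /=.
case: leP => th.
  rewrite cosK; first by field; lra.
  by rewrite in_itv /=; apply/andP; split; nra.
have -> : 2 * pi * t = - (2 * pi * (1 - t)) + pi *+ 2 by ring.
rewrite cosD2pi cosN cosK; first by field; lra.
by rewrite in_itv /=; apply/andP; split; nra.
Qed.

End Circle.

Section FundamentalGroup.
Variables (R : realType) (Y : ptopologicalType).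

Notation loop := (ptmap (circle R) Y).
Implicit Types a b c : loop.

Definition loop_mul_fun a b (z : circle R) : Y :=
  if 0 <= im z then a (circle_sqr z) else b (circle_sqr z).

Lemma loop_mul_continuous a b : continuous (loop_mul_fun a b).
Proof.
have cs c : continuous (fun z => c (circle_sqr z)).
  move=> z; apply: (@continuous_comp _ _ _ (@circle_sqr R) c).
    exact: circle_sqr_continuous.
  exact: ptmap_continuous.
apply: (@continuous_glue R _ _ (@im R)) (cs a) (cs b) _.
  exact: im_continuous.
by move=> z z0; rewrite circle_sqr_im0 // !ptmap_point.
Qed.

Lemma loop_mul_point a b : loop_mul_fun a b point = point.
Proof. by rewrite /loop_mul_fun circle_sqr_point !ptmap_point if_same. Qed.

(* Run through a on the upper half circle, then through b on the lower one,
   each at double speed: (a * b)(exp(is)) = a(exp(2is)) for 0 <= s <= pi and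
   b(exp(2is)) for pi <= s <= 2pi. *)
Definition loop_mul a b : loop :=
  PtMap (@loop_mul_continuous a b) (loop_mul_point a b).

Lemma loop_inv_continuous a : continuous (fun z => a (circle_conj z)).
Proof.
move=> z; apply: (@continuous_comp _ _ _ (@circle_conj R) a).
  exact: circle_conj_continuous.
exact: ptmap_continuous.
Qed.

Lemma loop_inv_point a : a (circle_conj point) = point.
Proof. by rewrite circle_conj_point ptmap_point. Qed.

Definition loop_inv a : loop :=
  PtMap (@loop_inv_continuous a) (loop_inv_point a).

Definition loop_one : loop := ptmap_cst (circle R) Y.

Lemma homotopic_mul a a' b b' : homotopic R a a' -> homotopic R b b' ->
  homotopic R (loop_mul a b) (loop_mul a' b').
Proof.
move=> /homotopicP[H [cH H0 H1 Hp]] /homotopicP[K [cK K0 K1 Kp]].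
apply/homotopicP.
exists (fun p => if 0 <= im p.2 then H (p.1, circle_sqr p.2)
                 else K (p.1, circle_sqr p.2)); split=> /= [|z|z|t].
- have cs : continuous (fun p : R * circle R => (p.1, circle_sqr p.2)).
    apply: continuous_pair => p; first exact: cvg_fst.
    by apply: continuous_comp; [exact: cvg_snd|exact: circle_sqr_continuous].
  apply: (@continuous_glue R (R * circle R)%type Y (fun p => im p.2)
    (fun p => H (p.1, circle_sqr p.2)) (fun p => K (p.1, circle_sqr p.2))).
  + move=> p; apply: (@continuous_comp _ _ _ snd (@im R)); first exact: cvg_snd.
    exact: im_continuous.
  + by move=> p; exact: (continuous_comp (cs p) (cH _)).
  + by move=> p; exact: (continuous_comp (cs p) (cK _)).
  + by move=> p p0; rewrite circle_sqr_im0 // Hp Kp.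
- by rewrite H0 K0.
- by rewrite H1 K1.
- by rewrite circle_sqr_point Hp Kp if_same.
Qed.

Lemma homotopic_inv a a' :
  homotopic R a a' -> homotopic R (loop_inv a) (loop_inv a').
Proof.
move=> /homotopicP[H [cH H0 H1 Hp]]; apply/homotopicP.
exists (fun p => H (p.1, circle_conj p.2)); split=> /= [|z|z|t].
- move=> p; apply: (@continuous_comp _ _ _
    (fun p : R * circle R => (p.1, circle_conj p.2)) H) (cH _).
  apply: continuous_pair => {}p; first exact: cvg_fst.
  by apply: continuous_comp; [exact: cvg_snd|exact: circle_conj_continuous].
- by rewrite H0.
- by rewrite H1.
- by rewrite circle_conj_point Hp.
Qed.

Lemma hausdorff_cylinder : hausdorff_space (R * circle R)%type.
Proof.
have hR : hausdorff_space (R * (R * R))%type by exact: norm_hausdorff.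
pose j (p : R * circle R) : R * (R * R) := (p.1, val p.2).
have cj : continuous j.
  apply: continuous_pair => p; first exact: cvg_fst.
  by apply: continuous_comp; [exact: cvg_snd|exact: circle_val_continuous].
move=> p q pq; have : j p = j q.
  apply: hR => A B /cj pA /cj qB.
  by have [w [wA wB]] := pq _ _ pA qB; exists (j w).
by case: p q {pq} => [s z] [t w] [-> /val_inj ->].
Qed.

(* A homotopy of loops parametrised by [0, 1] descends to the circle. *)
Lemma homotopic_exp a b (G : R * R -> Y) : continuous G ->
  (forall s, G (s, 0) = point) -> (forall s, G (s, 1) = point) ->
  (forall t, 0 <= t <= 1 -> G (0, t) = a (circle_exp t)) ->
  (forall t, 0 <= t <= 1 -> G (1, t) = b (circle_exp t)) ->
  homotopic R a b.
Proof.
move=> cG Gs0 Gs1 G0 G1.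
pose H (p : R * circle R) := G (p.1, circle_arg p.2).
pose F (p : R * R) := (p.1, circle_exp p.2).
have cF : continuous F.
  apply: continuous_pair => p; first exact: cvg_fst.
  by apply: continuous_comp; [exact: cvg_snd|exact: circle_exp_continuous].
have HF s t : 0 <= t <= 1 -> H (F (s, t)) = G (s, t).
  move=> t01; rewrite /H /F /=; have [->|tn1] := eqVneq t 1.
    by rewrite circle_exp1 -circle_exp0 circle_expK ?Gs0 ?Gs1 // ?lexx ?ler01
      // eq_sym oner_eq0.
  by rewrite circle_expK.
exists H; split=> [|z|z|t _].
- apply/continuous_closedP => C clC; apply/closed_subspaceP.
  pose K : set (R * R) := (`[0, 1] `*` `[0, 1]) `&` G @^-1` C.
  exists (F @` K).
    apply: compact_closed hausdorff_cylinder _.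
    apply: continuous_compact; first exact: continuous_subspaceT.
    apply: compact_closedI; first by apply: compact_setX; exact: segment_compact.
    exact: (continuous_closedP G).1.
  apply/seteqP; split=> [p [[[s t] [[/= s01 t01] GC] <-] p01]|[s z] [HC [s01 _]]].
    split=> //; suff : C (H (F (s, t))) by [].
    by rewrite HF //; move: t01; rewrite /= in_itv.
  split=> //; exists (s, circle_arg z); last by rewrite /F /= circle_argK.
  by split=> //; split=> //=; rewrite in_itv /= circle_arg01.
- by rewrite /H /= G0 ?circle_argK ?circle_arg01.
- by rewrite /H /= G1 ?circle_argK ?circle_arg01.
- rewrite /H /= -circle_exp0 circle_expK ?lexx ?ler01 // eq_sym ?oner_eq0 //.
Qed.

Lemma homotopic_reparam a b c (phi psi : R -> R) :
  continuous phi -> continuous psi ->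
  phi 0 = psi 0 -> phi 1 = psi 1 ->
  circle_exp (phi 0) = point -> circle_exp (phi 1) = point ->
  (forall t, 0 <= t <= 1 -> a (circle_exp t) = c (circle_exp (phi t))) ->
  (forall t, 0 <= t <= 1 -> b (circle_exp t) = c (circle_exp (psi t))) ->
  homotopic R a b.
Proof.
move=> cphi cpsi e0 e1 p0 p1 ha hb.
pose u (p : R * R) := phi p.2 + p.1 * (psi p.2 - phi p.2).
have c2 (f : R -> R) : continuous f -> continuous (fun q : R * R => f q.2).
  move=> cf q; apply: (@continuous_comp _ _ _ snd f) (cf _).
  exact: cvg_snd.
have cu : continuous u.
  move=> p; apply: (@continuousD _ _ _ (fun q : R * R => phi q.2)).
    exact: c2.
  apply: (@continuousM _ _ fst (fun q : R * R => psi q.2 - phi q.2)).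
    exact: cvg_fst.
  by apply: (@continuousB _ _ _ (fun q : R * R => psi q.2)); exact: c2.
have ceu : continuous (@circle_exp R \o u).
  by move=> p; exact: continuous_comp (cu p) (@circle_exp_continuous R _).
apply: (@homotopic_exp _ _ (c \o (@circle_exp R \o u))) => /=.
- by move=> p; exact: continuous_comp (ceu p) (@ptmap_continuous _ _ c _).
- by move=> s; rewrite /u /= -e0 subrr mulr0 addr0 p0 ptmap_point.
- by move=> s; rewrite /u /= -e1 subrr mulr0 addr0 p1 ptmap_point.
- by move=> t t01; rewrite /u /= mul0r addr0 ha.
- by move=> t t01; rewrite /u /= mul1r addrC subrK hb.
Qed.

Lemma loop_mul_exp a b t : 0 <= t <= 1 -> loop_mul a b (circle_exp t) =
  if t <= 2^-1 then a (circle_exp (2 * t)) else b (circle_exp (2 * t - 1)).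
Proof.
move=> t01; rewrite /= /loop_mul_fun im_exp_ge0 // circle_sqr_exp.
have [->|tn1] := eqVneq t 1.
  have -> : 2 * 1 - 1 = 1 :> R by ring.
  have -> : 2 * 1 = 1 + 1 :> R by ring.
  by rewrite orbT circle_expD1 circle_exp1 !ptmap_point if_same.
rewrite orbF; case: ifP => // _.
by rewrite -[in LHS](subrK 1 (2 * t)) circle_expD1.
Qed.

Lemma continuous_minr (f g : R -> R) : continuous f -> continuous g ->
  continuous (fun t => Num.min (f t) (g t)).
Proof. by move=> cf cg t; exact: continuous_min (cf t) (cg t). Qed.

Lemma continuous_maxr (f g : R -> R) : continuous f -> continuous g ->
  continuous (fun t => Num.max (f t) (g t)).
Proof. by move=> cf cg t; exact: continuous_max (cf t) (cg t). Qed.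

Lemma homotopic_mulA a b c :
  homotopic R (loop_mul a (loop_mul b c)) (loop_mul (loop_mul a b) c).
Proof.
pose phi (t : R) := Num.min (2 * t + 0) (Num.min (1 * t + 4^-1) (2^-1 * t + 2^-1)).
apply: homotopic_sym.
apply: (@homotopic_reparam _ _ (loop_mul a (loop_mul b c)) phi id).
- apply: (@continuous_minr (fun t => 2 * t + 0)); first exact: continuous_affine.
  apply: (@continuous_minr (fun t => 1 * t + 4^-1)); exact: continuous_affine.
- by move=> t; exact: cvg_id.
- by rewrite /phi /Num.min; do !case: ifPn; rewrite -?leNgt; lra.
- by rewrite /phi /Num.min; do !case: ifPn; rewrite -?leNgt; lra.
- rewrite (_ : phi 0 = 0) ?circle_exp0 //.
  by rewrite /phi /Num.min; do !case: ifPn; rewrite -?leNgt; lra.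
- rewrite (_ : phi 1 = 1) ?circle_exp1 //.
  by rewrite /phi /Num.min; do !case: ifPn; rewrite -?leNgt; lra.
- move=> t t01.
  have [t4|t4] := leP t 4^-1.
    have -> : phi t = 2 * t.
      by rewrite /phi /Num.min; do !case: ifPn; rewrite -?leNgt; lra.
    rewrite loop_mul_exp // ifT; last by lra.
    rewrite loop_mul_exp; last by lra.
    rewrite ifT; last by lra.
    rewrite loop_mul_exp; last by lra.
    by rewrite ifT //; lra.
  have [t2|t2] := leP t 2^-1.
    have -> : phi t = t + 4^-1.
      by rewrite /phi /Num.min; do !case: ifPn; rewrite -?leNgt; lra.
    rewrite loop_mul_exp // ifT; last by lra.
    rewrite loop_mul_exp; last by lra.
    rewrite ifF; last by apply/negbTE; rewrite -ltNge; lra.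
    rewrite loop_mul_exp; last by lra.
    rewrite ifF; last by apply/negbTE; rewrite -ltNge; lra.
    rewrite loop_mul_exp; last by lra.
    rewrite ifT; last by lra.
    by congr (b (circle_exp _)); lra.
  have -> : phi t = 2^-1 * t + 2^-1.
    by rewrite /phi /Num.min; do !case: ifPn; rewrite -?leNgt; lra.
  rewrite loop_mul_exp // ifF; last by apply/negbTE; rewrite -ltNge; lra.
  rewrite loop_mul_exp; last by lra.
  rewrite ifF; last by apply/negbTE; rewrite -ltNge; lra.
  rewrite loop_mul_exp; last by lra.
  rewrite ifF; last by apply/negbTE; rewrite -ltNge; lra.
  by congr (c (circle_exp _)); lra.
- by [].
Qed.

Lemma homotopic_mul1 a : homotopic R (loop_mul loop_one a) a.
Proof.
pose phi (t : R) := Num.max 0 (2 * t + -1).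
apply: (@homotopic_reparam _ _ a phi id).
- apply: (@continuous_maxr (cst 0)); first exact: cst_continuous.
  exact: continuous_affine.
- by move=> t; exact: cvg_id.
- by rewrite /phi /Num.max; case: ifPn; rewrite -?leNgt; lra.
- by rewrite /phi /Num.max; case: ifPn; rewrite -?leNgt; lra.
- rewrite (_ : phi 0 = 0) ?circle_exp0 //.
  by rewrite /phi /Num.max; case: ifPn; rewrite -?leNgt; lra.
- rewrite (_ : phi 1 = 1) ?circle_exp1 //.
  by rewrite /phi /Num.max; case: ifPn; rewrite -?leNgt; lra.
- move=> t t01; rewrite loop_mul_exp // /phi /Num.max.
  case: (leP t 2^-1) => t2; case: ifPn; rewrite -?leNgt => h //.
  + by exfalso; lra.
  + by rewrite circle_exp0 ptmap_point.
  + by exfalso; lra.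
- by [].
Qed.

Lemma homotopic_mulr1 a : homotopic R (loop_mul a loop_one) a.
Proof.
pose phi (t : R) := Num.min 1 (2 * t + 0).
apply: (@homotopic_reparam _ _ a phi id).
- apply: (@continuous_minr (cst 1)); first exact: cst_continuous.
  exact: continuous_affine.
- by move=> t; exact: cvg_id.
- by rewrite /phi /Num.min; case: ifPn; rewrite -?leNgt; lra.
- by rewrite /phi /Num.min; case: ifPn; rewrite -?leNgt; lra.
- rewrite (_ : phi 0 = 0) ?circle_exp0 //.
  by rewrite /phi /Num.min; case: ifPn; rewrite -?leNgt; lra.
- rewrite (_ : phi 1 = 1) ?circle_exp1 //.
  by rewrite /phi /Num.min; case: ifPn; rewrite -?leNgt; lra.
- move=> t t01; rewrite loop_mul_exp // /phi /Num.min addr0.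
  case: (leP t 2^-1) => t2; case: ifPn; rewrite -?leNgt => h //.
  + by exfalso; lra.
  + by rewrite circle_exp1 ptmap_point.
  + by exfalso; lra.
- by [].
Qed.

Lemma homotopic_mulV a : homotopic R (loop_mul (loop_inv a) a) loop_one.
Proof.
pose phi (t : R) := Num.max (2 * t + -1) (-2 * t + 1).
have phi0 : phi 0 = 1 by rewrite /phi /Num.max; case: ifPn; rewrite -?leNgt; lra.
have phi1 : phi 1 = 1 by rewrite /phi /Num.max; case: ifPn; rewrite -?leNgt; lra.
apply: (@homotopic_reparam _ _ a phi (cst 1)); rewrite ?phi0 ?phi1 ?circle_exp1 //.
- apply: (@continuous_maxr (fun t => 2 * t + -1));
    exact: continuous_affine.
- exact: cst_continuous.
- move=> t t01; rewrite loop_mul_exp // /= circle_conj_exp /phi /Num.max.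
  case: (leP t 2^-1) => t2; case: ifPn; rewrite -?leNgt => h //.
  + by congr (a (circle_exp _)); lra.
  + by congr (a (circle_exp _)); lra.
  + by exfalso; lra.
- by move=> t _; rewrite /= circle_exp1 ptmap_point.
Qed.

Lemma loop_invK a : homotopic R (loop_inv (loop_inv a)) a.
Proof.
have -> : loop_inv (loop_inv a) = a; last exact: homotopic_refl.
apply: ptmap_eq => z /=; congr (a _); apply: circle_eq => //.
by rewrite /im /= /im /= opprK.
Qed.

(* pi_1(Y) = [S^1, Y]. *)
Definition pi1 : Type := hclasses R (circle R) Y.

HB.instance Definition _ := Choice.on pi1.

Definition pi1_mul (u v : pi1) : pi1 := hclass R (loop_mul (repr u) (repr v)).
Definition pi1_inv (u : pi1) : pi1 := hclass R (loop_inv (repr u)).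
Definition pi1_one : pi1 := hclass R loop_one.

Lemma repr_hclass a : homotopic R (repr (hclass R a)) a.
Proof. by apply/hclass_eq; rewrite /hclass reprK. Qed.

Lemma pi1_mulE a b :
  pi1_mul (hclass R a) (hclass R b) = hclass R (loop_mul a b).
Proof. by apply/hclass_eq/homotopic_mul; exact: repr_hclass. Qed.

Lemma pi1_invE a : pi1_inv (hclass R a) = hclass R (loop_inv a).
Proof. by apply/hclass_eq/homotopic_inv; exact: repr_hclass. Qed.

Lemma pi1_mulA : associative pi1_mul.
Proof.
move=> u v w; have [a ->] := hclass_surj u; have [b ->] := hclass_surj v.
have [c ->] := hclass_surj w; rewrite !pi1_mulE.
by apply/hclass_eq; exact: homotopic_mulA.
Qed.

Lemma pi1_mul1 : left_id pi1_one pi1_mul.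
Proof.
move=> u; have [a ->] := hclass_surj u; rewrite pi1_mulE.
by apply/hclass_eq; exact: homotopic_mul1.
Qed.

Lemma pi1_mulr1 : right_id pi1_one pi1_mul.
Proof.
move=> u; have [a ->] := hclass_surj u; rewrite pi1_mulE.
by apply/hclass_eq; exact: homotopic_mulr1.
Qed.

Lemma pi1_mulV : left_inverse pi1_one pi1_inv pi1_mul.
Proof.
move=> u; have [a ->] := hclass_surj u; rewrite pi1_invE pi1_mulE.
by apply/hclass_eq; exact: homotopic_mulV.
Qed.

Lemma pi1_mulrV : right_inverse pi1_one pi1_inv pi1_mul.
Proof.
move=> u; have [a ->] := hclass_surj u; rewrite -[in RHS](pi1_mulV (hclass R (loop_inv a))).
rewrite !pi1_invE; congr (pi1_mul _ _).
by apply/esym/hclass_eq; exact: loop_invK.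
Qed.

HB.instance Definition _ :=
  isGroup.Build pi1 pi1_mulA pi1_mul1 pi1_mulr1 pi1_mulV pi1_mulrV.

End FundamentalGroup.

(* G = [G, G]: no proper subgroup contains all commutators. *)
Definition perfect (G : groupType) : Prop :=
  forall S : {pred G}, group_closed S ->
    (forall x y, [~ x, y]%g \in S) -> forall x, x \in S.

Section Hom.
Variables U V : zmodType.

(* Hom(U, V), an abelian group under pointwise addition. *)
Definition zhom : Type := {additive U -> V}.

HB.instance Definition _ := gen_eqMixin zhom.
HB.instance Definition _ := gen_choiceMixin zhom.

Definition zhom_fun (f : zhom) : U -> V := f.

Lemma zhom_eq (f g : zhom) : zhom_fun f =1 zhom_fun g -> f = g.
Proof.
case: f g => [f [[fm]]] [g [[gm]]] /funext /= fg.
rewrite /zhom_fun /= in fg; subst g.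
by rewrite (Prop_irrelevance fm gm).
Qed.

Definition zhom_zero : zhom := (\0 : U -> V)%R.
Definition zhom_add (f g : zhom) : zhom := zhom_fun f \+ zhom_fun g.
Definition zhom_opp (f : zhom) : zhom := \- zhom_fun f.

Lemma zhom_addA : associative zhom_add.
Proof. by move=> f g h; apply: zhom_eq => x; exact: addrA. Qed.

Lemma zhom_addC : commutative zhom_add.
Proof. by move=> f g; apply: zhom_eq => x; exact: addrC. Qed.

Lemma zhom_add0 : left_id zhom_zero zhom_add.
Proof. by move=> f; apply: zhom_eq => x; exact: add0r. Qed.

Lemma zhom_addN : left_inverse zhom_zero zhom_opp zhom_add.
Proof. by move=> f; apply: zhom_eq => x; exact: addNr. Qed.

HB.instance Definition _ :=
  GRing.isZmodule.Build zhom zhom_addA zhom_addC zhom_add0 zhom_addN.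

End Hom.

Section Chains.

Definition chains0 (X : choiceType) : zmodType := {freeg X}.

Variables X Y : choiceType.

Definition chains0_fun (f : X -> Y) : chains0 X -> chains0 Y :=
  fglift (fun x => << f x >> : {freeg Y}).

Lemma chains0_fun_additive f : zmod_morphism (chains0_fun f).
Proof. exact: lift_is_additive. Qed.

HB.instance Definition _ f :=
  GRing.isZmodMorphism.Build _ _ (chains0_fun f) (chains0_fun_additive f).

Definition chains0_map (f : X -> Y) : zhom (chains0 X) (chains0 Y) :=
  chains0_fun f.

(* f^r : X^r -> Y^r.  The topology of X^r plays no role in C_0(X^r). *)
Definition cartpow (r : nat) (f : X -> Y) (x : {ffun 'I_r -> X}) :
  {ffun 'I_r -> Y} := [ffun i => f (x i)].

End Chains.

Arguments cartpow {X Y} r f x.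

Section Degree.
Variables (R : realType) (X Y : ptopologicalType) (V : zmodType).
Variable f : hclasses R X Y -> V.

(* Deg f <= r *)
Definition degree_le (r : nat) : Prop :=
  exists l : {additive zhom (chains0 {ffun 'I_r -> X})
                           (chains0 {ffun 'I_r -> Y}) -> V},
    forall a : ptmap X Y, f (hclass R a) = l (chains0_map (cartpow r a)).

(* Deg f < oo *)
Definition finite_degree : Prop := exists r, degree_le r.

End Degree.

(* Main.v *)
(** The iterated differences of an invariant of degree at most r vanish to
    order r + 1: the value of a on r points of the circle only sees r of the
    arcs occupied by the factors of a product of r + 1 loops.  So f is
    polynomial on pi_1(Y).  If all first differences of f are constant, then
    f - f(1) is a homomorphism to an abelian group, hence zero on a perfect
    group; induction on the degree shows that f is constant. *)
Require Import Defs.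
From mathcomp Require Import all_boot all_order all_algebra.
From mathcomp Require Import all_classical reals topology.
From mathcomp.multinomials Require Import freeg.

Set Implicit Arguments.
Unset Strict Implicit.
Unset Printing Implicit Defensive.

Import Order.TTheory GRing.Theory Num.Theory.
Local Open Scope ring_scope.

Section Differences.
Variables (T : Type) (mul : T -> T -> T) (e : T).

(* The second argument is multiplied by e rather than left alone because
   loop_mul is unital only up to homotopy. *)
Definition difference (V : zmodType) (b : T) (F : T -> V) (a : T) : V :=
  F (mul a b) - F (mul a e).

(** The analogue of being a polynomial of degree less than [n]. *)
Fixpoint differences_vanish (V : zmodType) (n : nat) (F : T -> V) : Prop :=
  if n is m.+1 then forall b, differences_vanish m (difference b F)
  else forall a, F a = 0.

Lemma eq_differences_vanish (V : zmodType) n (F G : T -> V) :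
  F =1 G -> differences_vanish n F -> differences_vanish n G.
Proof. by move=> /funext ->. Qed.

Lemma differences_vanish0 (V : zmodType) n :
  differences_vanish n (fun=> 0 : V).
Proof.
elim: n => [|n IHn] //= b.
by apply: eq_differences_vanish IHn => a; rewrite /difference subr0.
Qed.

Lemma differences_vanishD (V : zmodType) n (F G : T -> V) :
  differences_vanish n F -> differences_vanish n G ->
  differences_vanish n (fun a => F a + G a).
Proof.
elim: n F G => [|n IHn] F G /= F0 G0; first by move=> a; rewrite F0 G0 addr0.
move=> b; apply: eq_differences_vanish (IHn _ _ (F0 b) (G0 b)) => a.
by rewrite /difference opprD addrACA.
Qed.

Lemma differences_vanish_additive (V W : zmodType) (l : {additive V -> W}) n
    (F : T -> V) :
  differences_vanish n F -> differences_vanish n (l \o F).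
Proof.
elim: n F => [|n IHn] F F0; first by move=> a /=; rewrite F0 raddf0.
move=> b; apply: eq_differences_vanish (IHn _ (F0 b)) => a.
by rewrite /= raddfB.
Qed.

Lemma differences_vanish_zhom (U V : zmodType) n (F : T -> zhom U V) :
  (forall x, differences_vanish n (fun a => zhom_fun (F a) x)) ->
  differences_vanish n F.
Proof.
elim: n F => [|n IHn] F F0; first by move=> a; apply: zhom_eq => x; exact: F0.
by move=> b; apply: IHn => x; exact: F0.
Qed.

End Differences.

(** Lets differences be computed on actual loops, where values at points make sense, and then
    carried over to homotopy classes. *)
Lemma differences_vanish_surj (S T : Type) (mulS : S -> S -> S) (eS : S)
    (mulT : T -> T -> T) (eT : T) (h : S -> T) (V : zmodType) n (f : T -> V) :
  (forall a b, h (mulS a b) = mulT (h a) (h b)) -> h eS = eT ->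
  (forall x, exists a, x = h a) ->
  differences_vanish mulS eS n (f \o h) -> differences_vanish mulT eT n f.
Proof.
move=> hM h1 hsurj; elim: n f => [|n IHn] f f0 x.
  by have [a ->] := hsurj x; exact: f0.
have [b ->] := hsurj x; apply: IHn; apply: eq_differences_vanish (f0 b) => a.
by rewrite /difference /= !hM h1.
Qed.

Lemma perfect_constant (G : groupType) (V : zmodType) n (f : G -> V) :
  perfect G -> differences_vanish (fun x y => x * y)%g 1%g n f ->
  forall x y, f x = f y.
Proof.
move=> perfG; elim: n f => [|n IHn] h h0 x y; first by rewrite !h0.
pose phi g := h g - h 1%g.
(* By induction the difference along [b] is constant; compare its values at [a] and at 1. *)
have hE a b : h (a * b)%g - h a = phi b.
  have := IHn _ (h0 b) a 1%g.
  by rewrite /difference !mulg1 mul1g.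
have phiM a b : phi (a * b)%g = phi a + phi b.
  by rewrite -[phi b](hE a) addrC /phi addrA subrK.
have phi1 : phi 1%g = 0 by rewrite /phi subrr.
have phiV a : phi a^-1%g = - phi a.
  by apply/eqP; rewrite -addr_eq0 -phiM mulVg phi1.
suff phi0 a : phi a = 0.
  by rewrite -[h x](subrK (h 1%g)) -[h y](subrK (h 1%g)) -!/(phi _) !phi0.
(* The kernel of [phi] is a subgroup, and it contains all commutators because [V] is abelian. *)
apply/eqP; apply: (perfG [pred g | phi g == 0]) => [|u v].
  split=> [|u v]; rewrite !inE ?phi1 //.
  by move=> /eqP u0 /eqP v0; rewrite phiM phiV u0 v0 subr0.
rewrite inE /commg /conjg !phiM !phiV; apply/eqP.
by rewrite addrA -opprD addNr.
Qed.

Section Loops.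
Variables (R : realType) (Y : ptopologicalType).
Local Notation loop := (ptmap (circle R) Y).

Definition determined_by (V : Type) (zs : seq (circle R)) (F : loop -> V) :=
  forall a b : loop, {in zs, a =1 b} -> F a = F b.

Lemma determined_by_vanish (V : zmodType) n (zs : seq (circle R))
    (F : loop -> V) : (size zs <= n)%N -> determined_by zs F ->
  differences_vanish (@loop_mul R Y) (loop_one R Y) n.+1 F.
Proof.
elim: n zs F => [|n IHn] zs F szs Fzs b.
  (* With no points to look at, [F] is constant, so one difference already kills it. *)
  by case: zs szs Fzs => // _ Fzs a; apply/eqP; rewrite subr_eq0; apply/eqP/Fzs.
change (differences_vanish (@loop_mul R Y) (loop_one R Y) n.+1
  (difference (@loop_mul R Y) (loop_one R Y) b F)).
(* [difference b F] a only sees a through the points of zs in the upper half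
   circle, and it vanishes if these are all of zs. *)
pose up := [seq z <- zs | 0 <= im z].
have [lower|] := boolP (has (fun z => ~~ (0 <= im z)) zs); last first.
  move=> /hasPn upper; apply: eq_differences_vanish (@differences_vanish0 _ _ _ _ _).
  move=> a; apply/esym/eqP; rewrite subr_eq0; apply/eqP/Fzs => z zzs /=.
  by rewrite /loop_mul_fun (negPn (upper z zzs)).
(* At an upper point [z], a product evaluates its first factor at [circle_sqr z]. Some point of [zs]
   lies below, so the new list is strictly shorter. *)
apply: (IHn (map (@circle_sqr R) up)).
  rewrite size_map size_filter -ltnS (leq_trans _ szs) //.
  by rewrite -[X in (_ < X)%N](count_predC (fun z => 0 <= im z)) -addn1 leq_add2l
    -has_count.
move=> a a' aa'; rewrite /difference.
have Fup c : F (loop_mul a c) = F (loop_mul a' c).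
  apply: Fzs => z zzs /=; rewrite /loop_mul_fun; case: ifP => // z0.
  by apply: aa'; apply: map_f; rewrite mem_filter z0.
by rewrite !Fup.
Qed.

(** By additivity it is enough to test on a multiple of a single tuple [x], whose image depends on
    [a] only through the [r] coordinates of [x]. *)
Lemma cartpow_vanish r :
  differences_vanish (@loop_mul R Y) (loop_one R Y) r.+1
    (fun a : loop => chains0_map (cartpow r a)).
Proof.
apply: differences_vanish_zhom => D.
elim/(@freeg_ind_dom0 int): D => [|k x D _ _ IHD].
  apply: eq_differences_vanish (@differences_vanish0 _ _ _ _ _) => a.
  by rewrite /zhom_fun raddf0.
pose F D a := zhom_fun (chains0_map (@cartpow (circle R) Y r (ptmap_fun a))) D.
apply: (@eq_differences_vanish _ _ _ _ _ (fun a => F << k *g x >> a + F D a)).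
  by move=> a; rewrite /zhom_fun raddfD.
apply: differences_vanishD IHD.
apply: (@determined_by_vanish _ _ [seq x i | i : 'I_r]).
  by rewrite size_map size_enum_ord.
move=> a b ab; rewrite /F /zhom_fun /= /chains0_fun !liftU.
suff -> : cartpow r a x = cartpow r b x by [].
apply/ffunP => i; rewrite !ffunE; apply: ab.
exact: map_f (mem_enum _ _).
Qed.

End Loops.

Theorem mainTheorem3 (R : realType) (Y : ptopologicalType) :
  perfect (pi1 R Y) ->
  forall (V : zmodType) (f : pi1 R Y -> V),
    finite_degree f -> forall u v : pi1 R Y, f u = f v.
Proof.
move=> perfY V f [r [l fl]]; apply: (@perfect_constant _ _ r.+1) perfY _.
apply: (@differences_vanish_surj _ _ (@loop_mul R Y) (loop_one R Y) _ _
  (@hclass R _ _)) => [a b|//|u|].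
- by rewrite -pi1_mulE.
- exact: hclass_surj.
(* On loops, [f] is the additive [l] applied to the Cartesian power, and additive maps preserve
   vanishing differences. *)
- apply: eq_differences_vanish
    (differences_vanish_additive l (@cartpow_vanish R Y r)) => a.
  by rewrite /= fl.
Qed.
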